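(* Let $N\ge2$, let $$\mathcal Q_N=\{\pi_{a,b}(X)=aX^2+bX\in\mathbb Z_N[X]:\ \pi_{a,b}\text{ permutes }\mathbb Z_N,\ a\not\equiv 0\pmod N\},$$ and let $$\mathcal Q^{\rm irr}_N=\{\pi_{a,b}\in\mathcal Q_N:\ \gcd(N,2a)<N\}.$$ Then the following are equivalent: (1) $\mathcal Q^{\rm irr}_N\neq\varnothing$ and, for every $\pi\in\mathcal Q^{\rm irr}_N$, every $u\in\mathbb Z$ with $\gcd(u,N)=1$ and every $q\in\mathbb Z$, the sequence $k\mapsto z_{u,q,N}(\pi(k))$ on $\mathbb Z_N$ is not equivalent to any Zadoff--Chu sequence; (2) $9\nmid N$ and ($8\mid N$ or $p^2\mid N$ for some odd prime $p$).
   Context: Write $\mathbb Z_N=\mathbb Z/N\mathbb Z$, $\zeta_N=\exp(-\pi\sqrt{-1}/N)$, $W_N=\zeta_N^2=\exp(-2\pi\sqrt{-1}/N)$, and $\varepsilon_N=N\bmod 2\in\{0,1\}$. For $u\in\mathbb Z$ with $\gcd(u,N)=1$ and $q\in\mathbb Z$, the length-$N$ Zadoff--Chu sequence is $z_{u,q,N}(t)=\zeta_N^{u(t+\varepsilon_N+2q)t}$; this depends only on $t$ modulo $N$, so it is a function on $\mathbb Z_N$. The quantity $\gcd(N,2a)$ is computed with any integer representative of $a\in\mathbb Z_N$. Equivalence is under the five operations on sequences $s:\mathbb Z_N\to\mathbb C$: $s(k)\mapsto c\,s(k)$ with $|c|=1$; $s(k)\mapsto s(k+d)$ with $d\in\mathbb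 Z_N$; $s(k)\mapsto s(rk)$ with $r\in\mathbb Z_N^\times$; $s(k)\mapsto W_N^{\lambda k}s(k)$ with $\lambda\in\mathbb Z_N$; $s(k)\mapsto\overline{s(k)}$. Equivalently, a sequence $s$ on $\mathbb Z_N$ is equivalent to a Zadoff--Chu sequence if there exist $\sigma\in\{\pm1\}$, $r\in\mathbb Z_N^\times$, $d,\lambda\in\mathbb Z_N$, $u'$ coprime to $N$, $q'$, and a unimodular constant $c$ such that $s(k)=c\,W_N^{\lambda k}\,\zeta_N^{\sigma u'(rk+d+\varepsilon_N+2q')(rk+d)}$ for all $k\in\mathbb Z_N$. *)

(* Defs.v *)
From HB Require Import structures.
From Stdlib Require Export Relations.
From mathcomp Require Export all_boot all_order all_algebra.
From mathcomp Require Export reals trigo classical_sets.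
From mathcomp Require Export complex.

Set Implicit Arguments.
Unset Strict Implicit.
Unset Printing Implicit Defensive.

Import Order.TTheory GRing.Theory Num.Theory.
Local Open Scope ring_scope.
Local Open Scope complex_scope.

(* The complex field is R[i] for R : realType; the integers mod N are 'Z_N,
   which is the intended ring only for N > 1. *)

Definition expi (R : realType) (x : R) : R[i] := cos x +i* sin x.

Definition zeta (R : realType) (N : nat) : R[i] := expi (- (pi / N%:R)).

Definition W (R : realType) (N : nat) : R[i] := zeta R N ^+ 2.

Definition zseq (R : realType) (N : nat) : Type := {ffun 'Z_N -> R[i]}.

(* The value depends only on t modulo N, so it is computed at the
   representative of t in {0, ..., N - 1}; the exponent is an int. *)
Definition zadoff_chu (R : realType) (N : nat) (u q : int) : zseq R N :=
  [ffun t : 'Z_N =>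
     let t' : int := Posz (val t) in
     zeta R N ^ (u * (t' + Posz (N %% 2)%N + 2 * q) * t')].

(* In modul_step, W is N-periodic in its exponent, so representatives of l and
   k are used. *)
Inductive seq_step (R : realType) (N : nat) (s : zseq R N) : zseq R N -> Prop :=
| scale_step (c : R[i]) of `|c| = 1 :
    seq_step s [ffun k => c * s k]
| shift_step (d : 'Z_N) :
    seq_step s [ffun k => s (k + d)]
| decim_step (r : 'Z_N) of r \is a GRing.unit :
    seq_step s [ffun k => s (r * k)]
| modul_step (l : 'Z_N) :
    seq_step s [ffun k => W R N ^+ (val l * val k)%N * s k]
| conj_step :
    seq_step s [ffun k => Num.conj (s k)].

Definition seq_equiv (R : realType) (N : nat) : zseq R N -> zseq R N -> Prop :=
  clos_refl_sym_trans (zseq R N) (@seq_step R N).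

Definition equiv_to_zadoff_chu (R : realType) (N : nat) (s : zseq R N) : Prop :=
  exists u q : int, coprimez u N /\ seq_equiv s (zadoff_chu R N u q).

Definition quad_poly (N : nat) (a b : 'Z_N) : {poly 'Z_N} :=
  a *: 'X^2 + b *: 'X.

Definition permutes (N : nat) (p : {poly 'Z_N}) : Prop :=
  bijective (fun x : 'Z_N => p.[x]).

Definition quad_perms (N : nat) : set {poly 'Z_N} :=
  [set p | exists a b : 'Z_N, [/\ p = quad_poly a b, permutes p & a != 0]]%classic.
Arguments quad_perms N : clear implicits.

Definition quad_perms_irr (N : nat) : set {poly 'Z_N} :=
  [set p | exists a b : 'Z_N,
     [/\ p = quad_poly a b, quad_perms N p & (gcdn N (2 * val a) < N)%N]]%classic.
Arguments quad_perms_irr N : clear implicits.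

Definition compose_perm (R : realType) (N : nat) (s : zseq R N)
    (p : {poly 'Z_N}) : zseq R N :=
  [ffun k => s p.[k]].

(* Main.v *)
(* Sequences equivalent to a Zadoff-Chu sequence have a quadratic phase, so
   their third multiplicative differences vanish.  For a Zadoff-Chu sequence
   composed with aX^2 + bX, the difference at -1 with step 1 yields
   N | 6a(a + b).  As aX^2 + bX permutes Z_d for every d | N, the number a + b
   is prime to N and, if 3 | N, then 3 | a; when 9 does not divide N this forces
   N | 2a, so an irreducible quadratic permutation leaves the class.  If 9 | N,
   X + (N/3)X^2 is an irreducible permutation that does not leave it. *)
Require Import Defs.
From mathcomp Require Import zify ring lra.
Import Order.TTheory GRing.Theory Num.Theory.
Local Open Scope ring_scope.
Local Open Scope complex_scope.
Set Implicit Arguments.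
Unset Strict Implicit.
Unset Printing Implicit Defensive.

(** * Roots of unity and the exact order of [zeta] *)

Lemma expiD (R : realType) (x y : R) : expi (x + y) = expi x * expi y.
Proof. by rewrite /expi cosD sinD; simpc; congr (_ +i* _); ring. Qed.

Lemma expi0 (R : realType) : expi (0 : R) = 1.
Proof. by rewrite /expi cos0 sin0. Qed.

Lemma expi_neq0 (R : realType) (x : R) : expi x != 0.
Proof.
apply/eqP => x0; have := expiD x (- x).
by rewrite x0 mul0r subrr expi0 => /eqP; rewrite oner_eq0.
Qed.

Lemma expiX (R : realType) (x : R) (n : nat) : expi x ^+ n = expi (n%:R * x).
Proof.
elim: n => [|n IHn]; first by rewrite mul0r expi0.
rewrite exprS IHn -expiD -{1}(mul1r x) -mulrDl.
by rewrite -[RHS]/(expi (n.+1%:R * x)) -natr1 addrC.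
Qed.

Lemma zeta_neq0 (R : realType) (N : nat) : zeta R N != 0.
Proof. exact: expi_neq0. Qed.

Lemma zeta_period (R : realType) (N : nat) :
  (0 < N)%N -> zeta R N ^+ (2 * N) = 1.
Proof.
move=> N0; rewrite expiX (_ : _ * _ = - (pi *+ 2)).
  by rewrite /expi cosN sinN cos2pi sin2pi oppr0.
by rewrite natrM; field; rewrite pnatr_eq0 -lt0n.
Qed.

(** Reduce m to its remainder r modulo 2N. If r > 0, put x = r pi / (2N): the real part gives cos 2x
    = 1, hence sin x = 0, although 0 < x < pi. *)
Lemma zeta_expz_eq1 (R : realType) (N : nat) (m : int) :
  (0 < N)%N -> zeta R N ^ m = 1 -> (Posz (2 * N) %| m)%Z.
Proof.
move=> N0; rewrite {1}(divz_eq m (2 * N)%N) expfzDr ?zeta_neq0//.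
rewrite [(_ %/ _)%Z * _]mulrC -exprz_exp.
rewrite -exprnP zeta_period// exp1rz mul1r => h.
apply/dvdz_mod0P; have := @ltz_pmod m (2 * N)%N (ltac:(lia)).
have := @modz_ge0 m (2 * N)%N (ltac:(lia)).
move: h; case: (modz _ _) => // r h _ rN; congr Posz.
apply/eqP; rewrite -leqn0 leqNgt; apply/negP => r0.
move: h; rewrite -exprnP expiX /expi => -[].
set x : R := r%:R * (pi / N%:R) / 2.
have -> : r%:R * - (pi / N%:R) = - (x *+ 2) :> R.
  by rewrite /x; field; rewrite pnatr_eq0 -lt0n.
rewrite cosN cos_mulr2n => h _.
have : 0 < sin x.
  apply: sin_gt0_pi.
  have -> : x = pi * (r%:R / (2 * N)%:R).
    by rewrite /x natrM; field; rewrite pnatr_eq0 -lt0n.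
  rewrite mulr_gt0 ?pi_gt0 ?divr_gt0 ?ltr0n ?muln_gt0//=.
  by rewrite gtr_pMr ?pi_gt0// ltr_pdivrMr ?ltr0n ?muln_gt0// mul1r ltr_nat.
suff -> : sin x = 0 by rewrite ltxx.
apply/eqP; rewrite -sqrf_eq0 sin2cos2; apply/eqP.
by lra.
Qed.

(** * Integer representatives of residues *)

Lemma intr_Zp_eq0 (N : nat) (k : int) :
  (1 < N)%N -> (k%:~R == 0 :> 'Z_N) = (Posz N %| k)%Z.
Proof.
move=> N1; have h n : (n%:R == 0 :> 'Z_N) = (N %| n)%N.
  by rewrite Zp_nat -val_eqE /= Zp_cast.
by case: k => n; rewrite ?NegzE ?mulrNz ?oppr_eq0 dvdzE /= ?abszN h.
Qed.

Lemma Zp_intr (N : nat) (x : 'Z_N) : (Posz (val x))%:~R = x.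
Proof. exact: natr_Zp. Qed.

Lemma zeta_expz_congr (R : realType) (N : nat) (m n : int) :
  (0 < N)%N -> (exists j, m = n + 2 * N%:Z * j) -> zeta R N ^ m = zeta R N ^ n.
Proof.
move=> N0 [j ->]; rewrite expfzDr ?zeta_neq0// -exprz_exp.
rewrite -[2 * _]/(Posz (2 * N)).
by rewrite -exprnP zeta_period// exp1rz mulr1.
Qed.

Lemma intP2 (k : int) : exists m, k = 2 * m \/ k = 2 * m + 1.
Proof. by exists (k %/ 2)%Z; lia. Qed.

(** Replacing t by t + jN changes the exponent by a multiple of 2N, because N has the parity of
    [N %% 2] and j(j + 1) is even. *)
Lemma zadoff_chuE (R : realType) (N : nat) (u q k : int) : (1 < N)%N ->
  zadoff_chu R N u q k%:~R
    = zeta R N ^ (u * (k + (N %% 2)%N%:Z + 2 * q) * k).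
Proof.
move=> N1; rewrite ffunE; set t := Posz (val _).
have : (Posz N %| k - t)%Z.
  by rewrite -(intr_Zp_eq0 _ N1) intrB Zp_intr subrr.
case/dvdzP=> j /eqP; rewrite subr_eq => /eqP ->.
apply/esym/zeta_expz_congr; first by lia.
have [h hN] : exists h, Posz N = Posz (N %% 2) + 2 * h.
  by exists (Posz (N %/ 2)); lia.
have [i ji] : exists i, j * (j + 1) = 2 * i.
  have [m [->|->]] := intP2 j; first by exists (m * (2 * m + 1)); ring.
  by exists ((2 * m + 1) * (m + 1)); ring.
exists (u * (t * j + h * j ^+ 2 + (N %% 2)%N%:Z * i + q * j)).
have -> : 2 * Posz N * (u * (t * j + h * j ^+ 2 + (N %% 2)%N%:Z * i + q * j)) =
    u * Posz N
    * (2 * t * j + 2 * h * j ^+ 2 + (N %% 2)%N%:Z * (2 * i) + 2 * q * j).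
  by ring.
rewrite -ji; move: hN; move: (Posz (N %% 2)) => e.
by move: (Posz N) => M ->; ring.
Qed.

(** * Quadratic phase and its invariance under equivalence *)

(* Vanishing of the third multiplicative differences, restricted to equal
   steps. *)
Definition quad_phase (R : realType) (N : nat) (s : 'Z_N -> R[i]) : Prop :=
  forall x f, s (x + f + f + f) * s (x + f) ^+ 3 = s (x + f + f) ^+ 3 * s x.

Lemma quad_phase_ext (R : realType) (N : nat) (s t : 'Z_N -> R[i]) :
  s =1 t -> quad_phase s -> quad_phase t.
Proof. by move=> st h x f; rewrite -!st. Qed.

Lemma quad_phaseM (R : realType) (N : nat) (s t : 'Z_N -> R[i]) :
  quad_phase s -> quad_phase t -> quad_phase (fun k => s k * t k).
Proof.
move=> hs ht x f; have := congr2 *%R (hs x f) (ht x f) => h.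
by rewrite !exprMn mulrACA h mulrACA.
Qed.

(** The pointwise inverse of c has quadratic phase too. This serves both scaling and modulation. *)
Lemma quad_phaseMl (R : realType) (N : nat) (c s : 'Z_N -> R[i]) :
  (forall k, c k != 0) -> quad_phase c ->
  quad_phase (fun k => c k * s k) <-> quad_phase s.
Proof.
move=> c0 hc; split=> hs; last exact: quad_phaseM.
have hV : quad_phase (fun k => (c k)^-1).
  by move=> x f; rewrite !exprVn -!invfM hc.
by apply: quad_phase_ext (quad_phaseM hV hs) => k; rewrite mulKf.
Qed.

Lemma W_neq0 (R : realType) (N : nat) : W R N != 0.
Proof. by rewrite expf_neq0 ?zeta_neq0. Qed.

(** Since W^N = 1, the factor is a character of the additive group of Z_N. *)
Lemma quad_phase_modul (R : realType) (N : nat) (l : 'Z_N) : (1 < N)%N ->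
  quad_phase (fun k : 'Z_N => W R N ^+ (val l * val k)%N).
Proof.
move=> N1; have W1 : W R N ^+ N = 1.
  by rewrite -exprM zeta_period// ltnW.
have addE (j k : 'Z_N) : W R N ^+ (val l * val (j + k)%R)%N
    = W R N ^+ (val l * val j)%N * W R N ^+ (val l * val k)%N.
  have -> : val (j + k)%R = ((val j + val k) %% N)%N.
    by congr modn; apply: Zp_cast.
  by rewrite -exprD -mulnDr !exprM expr_mod // -exprM mulnC exprM W1 expr1n.
by move=> x f; rewrite !addE; move: (_ ^+ _) (_ ^+ _) => y z; ring.
Qed.

(** An equivalence rather than an implication, because [seq_equiv] closes the steps under
    symmetry. *)
Lemma quad_phase_step (R : realType) (N : nat) (s t : zseq R N) :
  (1 < N)%N -> seq_step s t -> quad_phase s <-> quad_phase t.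
Proof.
move=> N1 [c c1|d|r ru|l|].
- have c0 : c != 0 by rewrite -normr_gt0 c1.
  have hc : quad_phase (fun _ : 'Z_N => c) by move=> x f /=; ring.
  apply: iff_trans (iff_sym (@quad_phaseMl _ _ _ s (fun=> c0) hc)) _.
  by split; apply: quad_phase_ext => k; rewrite ffunE.
- split=> h x f.
    by have := h (x + d) f; rewrite !(addrAC _ d) !ffunE.
  by have := h (x - d) f; rewrite !(addrAC _ (- d)) !ffunE !subrK.
- split=> h x f; first by rewrite !ffunE !mulrDr; apply: h.
  by have := h (r^-1 * x) (r^-1 * f); rewrite !ffunE !mulrDr !mulVKr.
- have c0 (k : 'Z_N) : W R N ^+ (val l * val k)%N != 0.
    by rewrite expf_neq0 ?W_neq0.
  apply: iff_trans (iff_sym (quad_phaseMl s c0 (quad_phase_modul R l N1))) _.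
  by split; apply: quad_phase_ext => k; rewrite ffunE.
- split=> h x f.
    by rewrite !ffunE -!rmorphXn -!rmorphM; congr (Num.conj _); apply: h.
  have := h x f; rewrite !ffunE -!rmorphXn -!rmorphM.
  by move/(congr1 Num.conj); rewrite !conjCK.
Qed.

Lemma quad_phase_equiv (R : realType) (N : nat) (s t : zseq R N) :
  (1 < N)%N -> seq_equiv s t -> quad_phase s <-> quad_phase t.
Proof.
move=> N1; elim=> {s t}// [s t|s t _|s t v _ ih1 _ ih2].
- exact: quad_phase_step.
- exact: iff_sym.
- exact: iff_trans ih1 ih2.
Qed.

Lemma quad_phase_zadoff_chu (R : realType) (N : nat) (u q : int) :
  (1 < N)%N -> quad_phase (zadoff_chu R N u q).
Proof.
move=> N1 x f; rewrite -(Zp_intr x) -(Zp_intr f) -!intrD !zadoff_chuE//.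
rewrite ![(_ ^ _) ^+ 3]exprnP !exprz_exp -!expfzDr ?zeta_neq0//.
by congr (_ ^ _); ring.
Qed.

(** * Zadoff-Chu sequences composed with quadratic polynomials *)

Lemma horner_quad_poly (N : nat) (a b x : 'Z_N) :
  (quad_poly a b).[x] = a * x ^+ 2 + b * x.
Proof. by rewrite /quad_poly !hornerE. Qed.

Lemma compose_permE (R : realType) (N : nat) (u q k : int) (a b : 'Z_N) :
  (1 < N)%N ->
  compose_perm (zadoff_chu R N u q) (quad_poly a b) k%:~R =
  let t := (val a)%:Z * k ^+ 2 + (val b)%:Z * k in
  zeta R N ^ (u * (t + (N %% 2)%N%:Z + 2 * q) * t).
Proof.
move=> N1; rewrite ffunE horner_quad_poly -{1}(Zp_intr a) -{1}(Zp_intr b).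
by rewrite -[k%:~R ^+ 2]rmorphXn -!intrM -intrD zadoff_chuE.
Qed.

Lemma quad_phase_quad_poly (R : realType) (N : nat) (u q : int) (a b : 'Z_N) :
  (1 < N)%N -> coprimez u N ->
  quad_phase (compose_perm (zadoff_chu R N u q) (quad_poly a b)) ->
  (N %| 6 * (val a * (val a + val b)))%N.
Proof.
move=> N1 uN /(_ (-1) 1).
have -> : (-1 : 'Z_N) = (-1)%:~R by rewrite mulrNz.
rewrite -[1%R]/(1%:~R) -!intrD !compose_permE//.
move=> h.
suff : (N%:Z %| 6 * ((val a)%:Z * ((val a)%:Z + (val b)%:Z)))%Z by [].
move: h; rewrite ![(_ ^ _) ^+ 3]exprnP !exprz_exp -!expfzDr ?zeta_neq0//.
set E := (X in _ ^ X = _); set F := (X in _ = _ ^ X) => EF.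
have : zeta R N ^ (E - F) = 1.
  by rewrite expfzDr ?zeta_neq0// EF -expfzDr ?zeta_neq0// subrr.
move/(zeta_expz_eq1 (ltnW N1)).
(* Up to the factor u, only the terms a^2 k^4 and 2ab k^3 of the phase have a nonzero third
   difference over -1, 0, 1, 2, namely 12a^2 and 12ab. The factor 2 cancels against the order 2N of
   [zeta]. *)
have -> : E - F = 2 * (u * (6 * ((val a)%:Z * ((val a)%:Z + (val b)%:Z)))).
  by rewrite /E /F; ring.
rewrite PoszM dvdz_mul2l// Gauss_dvdzr// coprimez_sym//.
Qed.

(** * Constraints on the coefficients of quadratic permutations *)

(* Surjectivity descends to the quotient mod [d], where it implies
   injectivity. *)
Lemma permutes_inj_mod (N d : nat) (a b : 'Z_N) (x y : nat) :
  (1 < N)%N -> (d %| N)%N -> permutes (quad_poly a b) ->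
  (val a * x ^ 2 + val b * x = val a * y ^ 2 + val b * y %[mod d])%N ->
  (x = y %[mod d])%N.
Proof.
move=> N1 dN [g _ gK]; have d0 : (0 < d)%N by apply: dvdn_gt0 dN; lia.
pose F (z : nat) := (val a * z ^ 2 + val b * z)%N.
have FE (z : nat) : (F z)%:R = (quad_poly a b).[z%:R] :> 'Z_N.
  by rewrite horner_quad_poly natrD natrM natrX natrM !natr_Zp.
have modF z : F z = F (z %% d)%N %[mod d].
  by rewrite /F -[RHS]modnDm -(modnMmr _ (_ ^ 2)) modnXm !modnMmr modnDm.
pose f (i : 'I_d) := Ordinal (ltn_pmod (F i) d0).
have surj (r : 'I_d) : exists i, f i = r.
  pose z : nat := val (g (val r)%:R).
  exists (Ordinal (ltn_pmod z d0)); apply: val_inj => /=.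
  rewrite -modF; have : (F z)%:R = (val r)%:R :> 'Z_N by rewrite FE natr_Zp gK.
  rewrite !Zp_nat => /(congr1 val) /=; rewrite Zp_cast// => zr.
  by rewrite -(modn_dvdm _ dN) zr (modn_dvdm _ dN) modn_small.
have [h hK] := fin_all_exists surj.
have f_inj : injective f by apply: can_inj (canF_sym hK).
move=> xy.
suff /(congr1 val) : Ordinal (ltn_pmod x d0) = Ordinal (ltn_pmod y d0) by [].
by apply/f_inj/val_inj => /=; rewrite -!modF.
Qed.

(** Modulo d = gcd(a + b, N), both 0 and 1 are sent to 0, so d = 1. *)
Lemma permutes_coprime (N : nat) (a b : 'Z_N) : (1 < N)%N ->
  permutes (quad_poly a b) -> coprime (val a + val b) N.
Proof.
move=> N1 ab; set d := gcdn (val a + val b) N.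
have := @permutes_inj_mod N d a b 1 0 N1 (dvdn_gcdr _ _) ab.
rewrite !muln1 exp0n// !muln0 mod0n => h; rewrite /coprime -dvdn1.
by apply/eqP/h/eqP; apply: dvdn_gcdl.
Qed.

(* If [a] is invertible mod [p], then [x] and [y] with
   [x + y = - b / a] have the same image; [x = y] for all such pairs is
   impossible when [p] is odd. *)
Lemma permutes_odd_prime (N p : nat) (a b : 'Z_N) : (1 < N)%N ->
  permutes (quad_poly a b) -> prime p -> odd p -> (p %| N)%N -> (p %| val a)%N.
Proof.
move=> N1 ab pp po pN; apply/negPn/negP => pa.
have inj x y := @permutes_inj_mod N p a b x y N1 pN ab.
have : coprime (val a) p by rewrite coprime_sym prime_coprime.
move: (val a) (val b) pa inj => {a b ab} a b pa inj.
case/coprimeP=> [|[u v] /= uv].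
  by case: a pa {inj} => //; rewrite dvdn0.
have p1 := prime_gt1 pp; have b_lt : (b %% p < p)%N by rewrite ltn_mod; lia.
(* As u inverts a modulo p, s represents - b / a. *)
pose s := (u * (p - b %% p))%N.
have ps : (p %| a * s + b)%N.
  have pr : (p - b %% p + b %% p = p)%N by rewrite subnK// ltnW.
  have -> : (a * s + b = p * (v * (p - b %% p) + (b %/ p).+1))%N.
    have -> : (a * s = (p * v + 1) * (p - b %% p))%N.
      by rewrite /s mulnA; congr muln; lia.
    move: pr (divn_eq b p).
    move: (p - b %% p)%N (b %% p)%N (b %/ p)%N => c r k.
    by move=> pr ->; lia.
  exact: dvdn_mulr.
(* The points s and 0 have the same image, so s vanishes modulo p, and with it b. *)
have s0 : (p %| s)%N.
  apply/eqP; rewrite -(mod0n p); apply: inj; rewrite exp0n// !muln0 mod0n.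
  have -> : (a * s ^ 2 + b * s = (a * s + b) * s)%N by ring.
  exact/eqP/dvdn_mulr.
have pb : (p %| b)%N by move: ps; rewrite dvdn_addr// dvdn_mull.
have [m pm] : exists m, p = m.+3.
  by case: (p) p1 po => [|[|[|m]]]// _ _; exists m.
(* Now b vanishes modulo p, so 1 and -1 have the same image. *)
have : (p.-1 = 1 %[mod p])%N.
  apply: inj; apply/eqP.
  have -> : (a * p.-1 ^ 2 + b * p.-1 =
      (p - 2) * (a * p + b) + (a * 1 ^ 2 + b * 1))%N.
    by rewrite pm /= subSS subSS subn0; ring.
  by rewrite eqn_mod_dvd ?leq_addl// addnK dvdn_mull// dvdn_add// dvdn_mull.
by rewrite pm /= !modn_small.
Qed.

(** The value at 2 is 2b modulo 4 and must differ from the value 0 at 0, so b is odd; a + b is odd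
    as well. *)
Lemma permutes_four (N : nat) (a b : 'Z_N) : (1 < N)%N ->
  permutes (quad_poly a b) -> (4 %| N)%N -> (2 %| val a)%N.
Proof.
move=> N1 ab N4; have /(coprime_dvdr (dvdn_trans (isT : 2 %| 4)%N N4)) :=
  permutes_coprime N1 ab.
rewrite coprimen2 => odd_ab.
have := @permutes_inj_mod N 4 a b 2 0 N1 N4 ab.
by move: odd_ab; move: (val a) (val b) => {a b ab} a b; lia.
Qed.

(** Cancelling a + b, which is prime to N, leaves N | 6a. If N = 3M, then 3 does not divide M, and M
    | 2a combines with 3 | a. *)
Lemma permutes_dvd2 (N : nat) (a b : 'Z_N) : (1 < N)%N ->
  permutes (quad_poly a b) -> ~~ (9 %| N)%N ->
  (N %| 6 * (val a * (val a + val b)))%N -> (N %| 2 * val a)%N.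
Proof.
move=> N1 ab N9; rewrite mulnA Gauss_dvdl; last first.
  by rewrite coprime_sym permutes_coprime.
rewrite -(mulnA 3 2 (val a)) => N6.
have [N3|N3] := boolP (3 %| N)%N; last first.
  by move: N6; rewrite Gauss_dvdr// coprime_sym prime_coprime.
have a3 := permutes_odd_prime N1 ab (isT : prime 3) isT N3.
have [M NM] := dvdnP N3; move: N6 N9 a3; move: (val a) => {N1 N3 a b ab} a.
rewrite NM mulnC dvdn_pmul2l// (@dvdn_pmul2l 3 3)// => M2 M3 a3.
by rewrite Gauss_dvd ?prime_coprime// M2 dvdn_mull.
Qed.

(** By contraposition, one prime at a time: otherwise the 2-part of N is at most 4, with a even if
    it is 4, and every odd prime p | N occurs once and divides a. So each prime-power part of N
    divides 2a. *)
Lemma permutes_irr_dvd (N : nat) (a b : 'Z_N) : (1 < N)%N ->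
  permutes (quad_poly a b) -> ~~ (N %| 2 * val a)%N ->
  (8 %| N)%N \/ exists p : nat, [/\ prime p, odd p & (p ^ 2 %| N)%N].
Proof.
move=> N1 ab; have N0 := ltnW N1.
have [N8|N8] := boolP (8 %| N)%N; first by left.
move=> Na; right; move: Na => /dvdn_partP-/(_ N0) Na.
apply: boolp.contrapT => noP; apply: Na => p.
rewrite mem_primes => /and3P[pp _ pN]; rewrite p_part.
have [p2|p_odd] := even_prime pp.
  subst p; move: N8; rewrite (@pfactor_dvdn 2 3)// -leqNgt.
  case: (logn 2 N) (@pfactor_dvdn 2 2 N isT N0) => [|[|[|]]]//= h _.
    by rewrite dvdn_mulr.
  by rewrite dvdn_mul// (permutes_four N1 ab)// (h : (4 %| N)%N = _).
have l1 : (logn p N <= 1)%N.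
  rewrite leqNgt; apply/negP => l2; apply: noP.
  by exists p; rewrite pp p_odd pfactor_dvdn.
have -> : logn p N = 1%N.
  by apply/eqP; rewrite eqn_leq l1 -pfactor_dvdn ?expn1.
by rewrite expn1 dvdn_mull// (permutes_odd_prime N1 ab).
Qed.

(** * Existence of irreducible quadratic permutations *)

(** The difference of two values is (x - y)(1 + w) with w = a(x + y), and 1 + w is a unit: w^3 = 0
    gives (1 + w)(1 - w + w^2) = 1. *)
Lemma permutes_nilpotent (N : nat) (a : 'Z_N) :
  a ^+ 3 = 0 -> permutes (quad_poly a 1).
Proof.
move=> a3; apply: injF_bij => x y; rewrite !horner_quad_poly !mul1r => xy.
have xy0 : (x - y) * (1 + a * (x + y)) = 0.
  by transitivity (a * x ^+ 2 + x - (a * y ^+ 2 + y)); [ring|rewrite xy subrr].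
apply/eqP; rewrite -subr_eq0; apply/eqP.
transitivity ((x - y) * (1 + a ^+ 3 * (x + y) ^+ 3)).
  by rewrite a3 mul0r addr0 mulr1.
transitivity ((x - y) * (1 + a * (x + y))
              * (1 - a * (x + y) + (a * (x + y)) ^+ 2)).
  by ring.
by rewrite xy0 mul0r.
Qed.

Lemma quad_perms_irr_nilpotent (N m : nat) : (1 < N)%N ->
  (N %| m ^ 3)%N -> ~~ (N %| 2 * m)%N ->
  quad_perms_irr N (quad_poly m%:R 1).
Proof.
move=> N1 m3 m2; have a3 : (m%:R : 'Z_N) ^+ 3 = 0.
  by apply/eqP; rewrite -natrX pmulrn intr_Zp_eq0.
exists m%:R, 1; split=> //.
  exists m%:R, 1; split=> //; first exact: permutes_nilpotent.
  by rewrite pmulrn intr_Zp_eq0//; apply: contra m2 => h; apply: dvdn_mull.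
rewrite Zp_nat /= Zp_cast// ltn_neqAle dvdn_leq ?dvdn_gcdl ?andbT//.
  by apply: contra m2 => /eqP/gcdn_idPl; rewrite /dvdn modnMmr.
exact: ltnW.
Qed.

(** Take m = N/4 if 8 | N, and m = N/p if p^2 | N. For N = 8 this is m = 2, whose square does not
    vanish modulo N; hence the cube. *)
Lemma exists_nilpotent (N : nat) : (1 < N)%N ->
  (8 %| N)%N \/ (exists p : nat, [/\ prime p, odd p & (p ^ 2 %| N)%N]) ->
  exists m, (N %| m ^ 3)%N /\ ~~ (N %| 2 * m)%N.
Proof.
move=> N1 [/dvdnP[k Nk]|[p [pp po /dvdnP[k Nk]]]].
  have k0 : (0 < k)%N by lia.
  exists (2 * k)%N; split.
    by apply/dvdnP; exists (k ^ 2)%N; rewrite Nk; ring.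
  by rewrite Nk mulnA mulnC dvdn_pmul2r.
have k0 : (0 < k)%N by case: k Nk => // Nk; move: N1; rewrite Nk.
exists (p * k)%N; split.
  by apply/dvdnP; exists (p * k ^ 2)%N; rewrite Nk; ring.
have p0 := prime_gt0 pp.
rewrite Nk (_ : k * p ^ 2 = p * (p * k))%N; last by ring.
rewrite dvdn_pmul2r ?muln_gt0 ?p0//; apply/negP => /dvdn_leq p2.
by move: (prime_gt1 pp) po (p2 isT); case: (p) => [|[|[|]]].
Qed.

(** * A permutation preserving the Zadoff-Chu class when 9 | N *)

Lemma intP3 (k : int) : exists m, k = 3 * m \/ k = 3 * m + 1 \/ k = 3 * m + 2.
Proof. by exists (k %/ 3)%Z; lia. Qed.

(* With [a = N / 3] one has [a ^ 2 = N * (N / 9)], so modulo [2 N] the quartic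
   and cubic terms [a ^ 2 k ^ 4 + 2 a k ^ 3] of the phase agree with linear
   ones; the linear excess is absorbed by a modulation. *)
Lemma nine_dvd_equiv (R : realType) (N : nat) : (1 < N)%N -> (9 %| N)%N ->
  let e := Posz (N %% 2) in
  equiv_to_zadoff_chu
    (compose_perm (zadoff_chu R N 1 e) (quad_poly (N %/ 3)%:R 1)).
Proof.
(* The choice q = e makes the coefficient e + 2q equal to 3e, so the extra quadratic term is
   3e(N/3)k^2 = eNk^2, which agrees with eNk modulo 2N. *)
move=> N1 /dvdnP[M NM] e; exists 1, 0; split; first exact: coprime1n.
(* 2Lk is the phase excess 9M^2 k^4 + 6M k^3 + 9Me k^2 + 2ek with each power of k replaced by k; the
   halving is exact since M and N have the same parity. *)
pose L := (N %/ 3 + N %% 2 + N * ((M + N %% 2) %/ 2))%N.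
apply/rst_sym/rst_step.
suff -> : compose_perm (zadoff_chu R N 1 e) (quad_poly (N %/ 3)%:R 1) =
    [ffun k => W R N ^+ (val (L%:R : 'Z_N) * val k)%N * zadoff_chu R N 1 0 k].
  exact: modul_step.
apply/ffunP => x; rewrite [RHS]ffunE -[x in LHS]Zp_intr.
rewrite -[x in _ * zadoff_chu _ _ _ _ x]Zp_intr.
rewrite compose_permE// zadoff_chuE// /W -exprM [zeta R N ^+ _]exprnP.
rewrite -expfzDr ?zeta_neq0//.
have -> : val ((N %/ 3)%:R : 'Z_N) = (3 * M)%N.
  by rewrite Zp_nat /= Zp_cast// modn_small; lia.
have -> : val (1 : 'Z_N) = 1%N by [].
have -> : val (L%:R : 'Z_N) = (L %% N)%N by rewrite Zp_nat /= Zp_cast.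
apply: zeta_expz_congr; first exact: ltnW.
have [i2 k2] : exists i, (val x)%:Z ^+ 2 - (val x)%:Z = 2 * i.
  have [m [->|->]] := intP2 (val x); first by exists (2 * m ^+ 2 - m); ring.
  by exists (2 * m ^+ 2 + m); ring.
have [i3 k3] : exists i, (val x)%:Z ^+ 3 - (val x)%:Z = 3 * i.
  have [m [->|[->|->]]] := intP3 (val x).
  - by exists (9 * m ^+ 3 - m); ring.
  - by exists (9 * m ^+ 3 + 9 * m ^+ 2 + 2 * m); ring.
  - by exists (9 * m ^+ 3 + 18 * m ^+ 2 + 11 * m + 2); ring.
have LN : Posz (L %% N) =
    3 * M%:Z + e + N%:Z * (((M + N %% 2) %/ 2)%N%:Z - (L %/ N)%N%:Z).
  have := divn_eq L N; rewrite {1}/L.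
  have -> : (N %/ 3 = 3 * M)%N by lia.
  rewrite /e => /(congr1 Posz); rewrite !PoszD !PoszM.
  by move: (Posz (L %% N)) => z hz; lia.
have he : M%:Z = 2 * ((M + N %% 2) %/ 2)%N%:Z - e by rewrite /e; lia.
rewrite !PoszM {}LN -[(N %% 2)%N%:Z]/e; have -> : N%:Z = 9 * M%:Z by lia.
move: k2 k3 he; move: (Posz (val x)) => k; move: (Posz (L %/ N)) => j.
move: (Posz ((M + _) %/ 2)) e => h e k2 k3 Me.
(* These are the quotients by 2N = 18M of 9M^2 (k^4 - k), 6M(k^3 - k), 9Me(k^2 - k) and 2Njk, the
   last from reducing L modulo N; k^4 - k factors as (k^2 - k)(k^2 + k + 1). *)
exists (M%:Z * i2 * (k ^+ 2 + k + 1) + i3 + e * i2 + j * k).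
rewrite (_ : 2 * (9 * M%:Z) * _ =
  9 * M%:Z * M%:Z * (2 * i2) * (k ^+ 2 + k + 1) + 6 * M%:Z * (3 * i3)
  + e * 9 * M%:Z * (2 * i2) + 18 * M%:Z * j * k); last by ring.
by rewrite -k2 -k3 Me; ring.
Qed.

(** * Assembly of the two implications *)

Theorem corollary2 (R : realType) (N : nat) (hN : (2 <= N)%N) :
  ((quad_perms_irr N !=set0)%classic /\
   forall p : {poly 'Z_N}, quad_perms_irr N p ->
   forall u : int, coprimez u N ->
   forall q : int,
     ~ equiv_to_zadoff_chu (compose_perm (zadoff_chu R N u q) p))
  <->
  (~ (9 %| N)%N /\
   ((8 %| N)%N \/ exists p : nat, [/\ prime p, odd p & (p ^ 2 %| N)%N])).
Proof.
have irrP p : quad_perms_irr N p -> exists a b : 'Z_N,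
    [/\ p = quad_poly a b, permutes p & ~~ (N %| 2 * val a)%N].
  move=> [a [b [-> [a' [b' [_ ab _]]] Na]]]; exists a, b; split=> //.
  by apply/negP => /gcdn_idPl Na'; rewrite Na' ltnn in Na.
split=> [[[p /irrP[a [b [-> ab Na]]]] noequiv]|[N9 /(exists_nilpotent hN)]].
  (* Any single irreducible permutation yields the divisibility by 8 or p^2; non-equivalence is what
     excludes 9 | N. *)
  split; last exact: permutes_irr_dvd ab Na.
  move=> N9; apply: noequiv (nine_dvd_equiv R hN N9); last exact: coprime1n.
  have [M NM] := dvdnP N9; apply: quad_perms_irr_nilpotent => //.
    have -> : (N %/ 3 = 3 * M)%N by lia.
    by apply/dvdnP; exists (3 * M ^ 2)%N; rewrite NM; ring.
  by apply/negP => /dvdn_leq; lia.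
move=> [m [m3 m2]]; split.
  by exists (quad_poly m%:R 1); apply: quad_perms_irr_nilpotent.
move=> _ /irrP[a [b [-> ab /negP Na]]] u uN q [u' [q' [_ sz]]]; apply: Na.
apply: permutes_dvd2 ab _ _ => //; first exact/negP.
apply: quad_phase_quad_poly uN _ => //.
exact/(quad_phase_equiv hN sz)/quad_phase_zadoff_chu.
Qed.
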